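(* Let $\mathfrak{g}, \mathfrak{h}$ be two Leibniz algebras, let $\mathfrak{h}$ be a Leibniz $\mathfrak{g}$-representation with actions $\rho^L,\rho^R$, and let $T : \mathfrak{h} \rightarrow \mathfrak{g}$ be a $\lambda$-weighted relative Rota-Baxter operator. Then $(\mathfrak{g}, \varrho^L, \varrho^R)$ is a representation of the induced Leibniz algebra $\mathfrak{h}_T$, with left and right $\mathfrak{h}_T$-actions given by $$\varrho^L : \mathfrak{h}_T \otimes \mathfrak{g} \rightarrow \mathfrak{g}, \quad \varrho^L (u,x) = [Tu,x]_\mathfrak{g} - T (\rho^R (u,x)),$$ $$\varrho^R : \mathfrak{g} \otimes \mathfrak{h}_T \rightarrow \mathfrak{g}, \quad \varrho^R (x,u) = [x, Tu]_\mathfrak{g} - T (\rho^L (x,u)).$$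
   Context: All vector spaces and (multi)linear maps are over a field $\mathbf{k}$ of characteristic $0$, and $\lambda \in \mathbf{k}$ is a fixed scalar. A (left) Leibniz algebra is a vector space $\mathfrak{g}$ with a bilinear bracket $[~,~]_\mathfrak{g}$ satisfying $[x,[y,z]_\mathfrak{g}]_\mathfrak{g} = [[x,y]_\mathfrak{g},z]_\mathfrak{g} + [y,[x,z]_\mathfrak{g}]_\mathfrak{g}$ for all $x,y,z$. A representation of $\mathfrak{g}$ is a vector space $V$ with bilinear maps $\rho^L : \mathfrak{g}\otimes V \to V$, $\rho^R : V \otimes \mathfrak{g} \to V$ such that for $x,y\in\mathfrak{g}$, $v \in V$: $\rho^L(x,\rho^L(y,v)) = \rho^L([x,y]_\mathfrak{g},v) + \rho^L(y,\rho^L(x,v))$; $\rho^L(x,\rho^R(v,y)) = \rho^R(\rho^L(x,v),y) + \rho^R(v,[x,y]_\mathfrak{g})$; $\rho^R(v,[x,y]_\mathfrak{g}) = \rho^R(\rho^R(v,x),y) + \rho^L(x,\rho^R(v,y))$. A Leibniz algebra $\mathfrak{h}$ is a Leibniz $\mathfrak{g}$-representation if it has maps $\rho^L,\rho^R$ making it a representation of $\mathfrak{g}$ and, for $u,v\in\mathfrak{h}$, $x\in\mathfrak{g}$: $[u,\rho^R(v,x)]_\mathfrak{h} = \rho^R([u,v]_\mathfrak{h},x) + [v,\rho^R(u,x)]_\mathfrak{h}$; $[u,\rho^L(x,v)]_\mathfrak{h} = [\rho^R(u,x),v]_\mathfrak{h} + \rho^L(x,[u,v]_\mathfrak{h})$;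 $\rho^L(x,[u,v]_\mathfrak{h}) = [\rho^L(x,u),v]_\mathfrak{h} + [u,\rho^L(x,v)]_\mathfrak{h}$. A linear map $T:\mathfrak{h}\to\mathfrak{g}$ is a $\lambda$-weighted relative Rota-Baxter operator if $[Tu,Tv]_\mathfrak{g} = T(\rho^L(Tu,v)+\rho^R(u,Tv)+\lambda[u,v]_\mathfrak{h})$ for all $u,v\in\mathfrak{h}$. The induced Leibniz algebra $\mathfrak{h}_T$ is the vector space $\mathfrak{h}$ with the bracket $[u,v]_T = \rho^L(Tu,v)+\rho^R(u,Tv)+\lambda[u,v]_\mathfrak{h}$ (which is a Leibniz bracket). *)

(* Defs.v *)
From HB Require Import structures.
From mathcomp Require Import all_boot all_order all_algebra.
Set Implicit Arguments.
Unset Strict Implicit.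
Unset Printing Implicit Defensive.
Import GRing.Theory.
Local Open Scope ring_scope.

Reserved Notation "\[ x , y ]" (at level 0, x, y at level 99,
  format "\[ x ,  y ]").

(* Left Leibniz algebras: left multiplications are derivations. *)
HB.mixin Record Lmodule_isLeibniz (k : fieldType) g of GRing.Lmodule k g := {
  bracket : g -> g -> g;
  bracket_bilinear : bilinear_for *:%R *:%R bracket;
  bracket_leibniz : forall x y z : g,
    bracket x (bracket y z) = bracket (bracket x y) z + bracket y (bracket x z)
}.

#[short(type="leibnizType")]
HB.structure Definition Leibniz (k : fieldType) :=
  { g of Lmodule_isLeibniz k g & GRing.Lmodule k g }.

Notation "\[ x , y ]" := (bracket x y) : ring_scope.

Record is_representation (k : fieldType) (g : leibnizType k) (V : lmodType k)
    (rhoL : g -> V -> V) (rhoR : V -> g -> V) : Prop := IsRepresentation {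
  rep_bilinearL : bilinear_for *:%R *:%R rhoL;
  rep_bilinearR : bilinear_for *:%R *:%R rhoR;
  rep_LL : forall x y v,
    rhoL x (rhoL y v) = rhoL \[x, y] v + rhoL y (rhoL x v);
  rep_LR : forall x v y,
    rhoL x (rhoR v y) = rhoR (rhoL x v) y + rhoR v \[x, y];
  rep_RR : forall v x y,
    rhoR v \[x, y] = rhoR (rhoR v x) y + rhoL x (rhoR v y)
}.

Record is_leibniz_representation (k : fieldType) (g h : leibnizType k)
    (rhoL : g -> h -> h) (rhoR : h -> g -> h) : Prop :=
  IsLeibnizRepresentation {
  lrep_rep : is_representation rhoL rhoR;
  lrep_bracketR : forall u v x,
    \[u, rhoR v x] = rhoR \[u, v] x + \[v, rhoR u x];
  lrep_bracketL : forall u x v,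
    \[u, rhoL x v] = \[rhoR u x, v] + rhoL x \[u, v];
  lrep_derivation : forall x u v,
    rhoL x \[u, v] = \[rhoL x u, v] + \[u, rhoL x v]
}.

Definition induced_bracket (k : fieldType) (lambda : k) (g h : leibnizType k)
    (rhoL : g -> h -> h) (rhoR : h -> g -> h) (T : h -> g) (u v : h) : h :=
  rhoL (T u) v + rhoR u (T v) + lambda *: \[u, v].

Definition is_relative_rota_baxter (k : fieldType) (lambda : k)
    (g h : leibnizType k) (rhoL : g -> h -> h) (rhoR : h -> g -> h)
    (T : {linear h -> g}) : Prop :=
  forall u v : h,
    \[T u, T v] = T (rhoL (T u) v + rhoR u (T v) + lambda *: \[u, v]).

(* The vector space underlying the induced Leibniz algebra h_T.  It is an alias
   of h, so that h_T and h carry different brackets; the proof arguments are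
   what make the induced bracket a Leibniz bracket. *)
Definition induced (k : fieldType) (lambda : k) (g h : leibnizType k)
    (rhoL : g -> h -> h) (rhoR : h -> g -> h) (T : {linear h -> g})
    (hrep : is_leibniz_representation rhoL rhoR)
    (hT : is_relative_rota_baxter lambda rhoL rhoR T) : Type := h.

Section InducedLeibniz.
Variables (k : fieldType) (lambda : k) (g h : leibnizType k).
Variables (rhoL : g -> h -> h) (rhoR : h -> g -> h) (T : {linear h -> g}).
Hypothesis hrep : is_leibniz_representation rhoL rhoR.
Hypothesis hT : is_relative_rota_baxter lambda rhoL rhoR T.

Local Notation brT := (induced_bracket lambda rhoL rhoR T).

Lemma induced_bracket_bilinear : bilinear_for *:%R *:%R brT.
Proof.
have [[[Ll Lr] [Rl Rr] _ _ _] _ _ _] := hrep.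
have [Bl Br] := @bracket_bilinear k h.
split=> u a v w /=; rewrite /induced_bracket linearP /=.
- rewrite (Ll u) (Rl (T u)) (Bl u) /= !scalerDr !scalerA (mulrC a).
  by rewrite [X in X + _ = _]addrACA [LHS]addrACA.
- rewrite (Lr (T u)) (Rr u) (Br u) /= !scalerDr !scalerA (mulrC a).
  by rewrite [X in X + _ = _]addrACA [LHS]addrACA.
Qed.

Lemma induced_bracket_leibniz u v w :
  brT u (brT v w) = brT (brT u v) w + brT v (brT u w).
Proof.
have [[[Ll Lr] [Rl Rr] LL LR RR] BR BL D] := hrep.
have [Bl Br] := @bracket_bilinear k h.
have lD (f : h -> h) : linear f -> {morph f : x y / x + y}.
  by move=> fl x y; have := fl 1 x y; rewrite !scale1r.
have lZ (f : h -> h) : linear f -> forall a, {morph f : x / a *: x}.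
  move=> fl a x; have f0 : f 0 = 0.
    by have := fl 1 0 0; rewrite !scale1r addr0 -{1}[f 0]addr0 => /addrI <-.
  by have := fl a x 0; rewrite f0 !addr0.
have E x y : T (brT x y) = \[T x, T y] by rewrite hT.
rewrite {1 3 5}/induced_bracket !E /induced_bracket.
rewrite !(lD _ (Lr _)) !(lD _ (Rl _)) !(lD _ (Bl _)) !(lD _ (Br _)).
rewrite !(lZ _ (Lr _)) !(lZ _ (Rl _)) !(lZ _ (Bl _)) !(lZ _ (Br _)).
rewrite (LL (T u) (T v)) (LR (T u)) (RR u) (D (T u)) (BL u) (BR u).
rewrite (bracket_leibniz u) !scalerDr !addrA.
by rewrite [LHS](ACl (1*3*7*11*5*9*13*2*8*10*4*6*12*14)).
Qed.

Local Notation h_T := (induced hrep hT).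

HB.instance Definition _ := GRing.Lmodule.on h_T.
HB.instance Definition _ := Lmodule_isLeibniz.Build k h_T
  induced_bracket_bilinear induced_bracket_leibniz.

End InducedLeibniz.

(* Main.v *)
Require Import Defs.
From HB Require Import structures.
From mathcomp Require Import all_boot all_order all_algebra.
Set Implicit Arguments.
Unset Strict Implicit.
Unset Printing Implicit Defensive.
Import GRing.Theory.
Local Open Scope ring_scope.

(** On [g * h] the actions and the [lambda]-scaled bracket of [h] define a
    semidirect Leibniz bracket ([semidirect_leibniz]).  The operator [T] is a
    relative Rota-Baxter operator exactly when its graph, the set of pairs
    [(T u, u)], is a subalgebra for this bracket, and the graph is then a copy
    of the induced algebra [h_T] ([semidirect_graph]).

    A subalgebra acts on the whole algebra by left and right multiplication and
    preserves itself, so it acts on the quotient vector space.  The quotient of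
    [g * h] by the graph is [g] itself, through the projection
    [(x, u) |-> x - T u], and the quotient actions are the two maps of the
    theorem ([graph_projL] and [graph_projR]).  The three identities of a
    representation are thus projections of the Leibniz identity of [g * h], in
    which one entry is [(x, 0)] and the other two lie on the graph. *)

Section Bilinear.
Variables (k : fieldType) (U V W : lmodType k) (f : U -> V -> W).
Hypothesis bf : bilinear_for *:%R *:%R f.

Lemma bilinDl v : {morph f^~ v : x y / x + y}.
Proof. by move=> x y; have /= := bf.1 v 1 x y; rewrite !scale1r. Qed.

Lemma bilinDr u : {morph f u : x y / x + y}.
Proof. by move=> x y; have /= := bf.2 u 1 x y; rewrite !scale1r. Qed.

Lemma bilin0l v : f 0 v = 0.
Proof.
by apply: (addrI (f 0 v)); have /= <- := bilinDl v 0 0; rewrite !addr0.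
Qed.

Lemma bilin0r u : f u 0 = 0.
Proof.
by apply: (addrI (f u 0)); have /= <- := bilinDr u 0 0; rewrite !addr0.
Qed.

Lemma bilinZl v a : {morph f^~ v : x / a *: x}.
Proof. by move=> x; have /= := bf.1 v a x 0; rewrite bilin0l !addr0. Qed.

Lemma bilinZr u a : {morph f u : x / a *: x}.
Proof. by move=> x; have /= := bf.2 u a x 0; rewrite bilin0r !addr0. Qed.

Lemma bilinBl v : {morph f^~ v : x y / x - y}.
Proof. by move=> x y; rewrite bilinDl -scaleN1r bilinZl scaleN1r. Qed.

Lemma bilinBr u : {morph f u : x y / x - y}.
Proof. by move=> x y; rewrite bilinDr -scaleN1r bilinZr scaleN1r. Qed.

End Bilinear.

Section Graph.
Variables (k : fieldType) (lambda : k) (g h : leibnizType k).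
Variables (rhoL : g -> h -> h) (rhoR : h -> g -> h).
Hypothesis hrep : is_leibniz_representation rhoL rhoR.

Definition semidirect (p q : g * h) : g * h :=
  (\[p.1, q.1], rhoL p.1 q.2 + rhoR p.2 q.1 + lambda *: \[p.2, q.2]).

Let bL := rep_bilinearL (lrep_rep hrep).
Let bR := rep_bilinearR (lrep_rep hrep).
Let bg := @bracket_bilinear k g.
Let bh := @bracket_bilinear k h.

Lemma semidirect_leibniz p q r :
  semidirect p (semidirect q r) =
  semidirect (semidirect p q) r + semidirect q (semidirect p r).
Proof.
have [[_ _ LL LR RR] BR BL D] := hrep.
case: p q r => [x u] [y v] [z w]; congr pair => /=.
  exact: bracket_leibniz.
rewrite !(bilinDr bL) !(bilinDl bR) !(bilinDr bh) !(bilinDl bh).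
rewrite !(bilinZr bL) !(bilinZl bR) !(bilinZr bh) !(bilinZl bh).
(* In the second component, the terms split according to which of the three
   entries come from [g]; each of the seven cases is one axiom. *)
rewrite (LL x y) (LR x) (RR u) (D x) (BL u) (BR u) (bracket_leibniz u).
rewrite !scalerDr !addrA.
by rewrite [LHS](ACl (1*3*7*11*5*9*13*2*8*10*4*6*12*14)).
Qed.

Variable T : {linear h -> g}.
Hypothesis hT : is_relative_rota_baxter lambda rhoL rhoR T.

Definition graph (u : h) : g * h := (T u, u).

(** The quotient of [g * h] by the graph of [T], each class being represented
    by its element with zero second component. *)
Definition graph_proj (p : g * h) : g := p.1 - T p.2.

Definition actL (u : h) (x : g) : g := \[T u, x] - T (rhoR u x).
Definition actR (x : g) (u : h) : g := \[x, T u] - T (rhoL x u).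

Lemma graph_projD p q : graph_proj (p + q) = graph_proj p + graph_proj q.
Proof. by rewrite /graph_proj /= linearD opprD addrACA. Qed.

Lemma graph_proj_inl x : graph_proj (x, 0) = x.
Proof. by rewrite /graph_proj /= linear0 subr0. Qed.

Lemma semidirect_graph u v :
  semidirect (graph u) (graph v) =
  graph (induced_bracket lambda rhoL rhoR T u v).
Proof. by rewrite /semidirect /graph /= hT. Qed.

(** Since the graph is closed under the bracket, left multiplication by
    [graph u] descends to the quotient. *)
Lemma graph_projL u p :
  graph_proj (semidirect (graph u) p) = actL u (graph_proj p).
Proof.
case: p => x v; rewrite /graph_proj /actL /=.
rewrite (bilinBr bg) (bilinBr bR) linearB hT !linearD /=.
rewrite !opprK !addrA.
(* The term [- T (rhoR u (T v))] in the Rota-Baxter expansion of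
   [- \[T u, T v]] cancels the one from [- T (rhoR u (x - T v))]. *)
by rewrite [RHS](ACl (1*2*5*4*(3*6))) /= addNr addr0.
Qed.

Lemma graph_projR u p :
  graph_proj (semidirect p (graph u)) = actR (graph_proj p) u.
Proof.
case: p => x v; rewrite /graph_proj /actR /=.
rewrite (bilinBl bg) (bilinBl bL) linearB hT !linearD /=.
rewrite !opprK !addrA.
by rewrite [RHS](ACl (1*5*3*4*(2*6))) /= addNr addr0.
Qed.

Lemma actL_bilinear : bilinear_for *:%R *:%R actL.
Proof.
split=> [x a u v | u a x y] /=; rewrite /actL.
  rewrite linearP (bilinDl bg) (bilinZl bg) (bilinDl bR) (bilinZl bR) linearP.
  by rewrite scalerBr opprD addrACA.
rewrite (bilinDr bg) (bilinZr bg) (bilinDr bR) (bilinZr bR) linearP.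
by rewrite scalerBr opprD addrACA.
Qed.

Lemma actR_bilinear : bilinear_for *:%R *:%R actR.
Proof.
split=> [u a x y | x a u v] /=; rewrite /actR.
  rewrite (bilinDl bg) (bilinZl bg) (bilinDl bL) (bilinZl bL) linearP.
  by rewrite scalerBr opprD addrACA.
rewrite linearP (bilinDr bg) (bilinZr bg) (bilinDr bL) (bilinZr bL) linearP.
by rewrite scalerBr opprD addrACA.
Qed.

End Graph.

Theorem proposition4p2 (k : fieldType) (char_k : [pchar k] =i pred0)
    (lambda : k) (g h : leibnizType k)
    (rhoL : g -> h -> h) (rhoR : h -> g -> h)
    (hrep : is_leibniz_representation rhoL rhoR)
    (T : {linear h -> g})
    (hT : is_relative_rota_baxter lambda rhoL rhoR T) :
  is_representation (g := induced hrep hT) (V := g)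
    (fun (u : induced hrep hT) (x : g) => \[T u, x] - T (rhoR u x))
    (fun (x : g) (u : induced hrep hT) => \[x, T u] - T (rhoL x u)).
Proof.
pose L := actL rhoR T; pose R := actR rhoL T.
pose br := induced_bracket lambda rhoL rhoR T.
pose S := semidirect lambda rhoL rhoR.
have S_leibniz : forall p q r, S p (S q r) = S (S p q) r + S q (S p r).
  exact: semidirect_leibniz.
have projL u p : graph_proj T (S (graph T u) p) = L u (graph_proj T p).
  exact: graph_projL.
have projR u p : graph_proj T (S p (graph T u)) = R (graph_proj T p) u.
  exact: graph_projR.
have graphS u v : S (graph T u) (graph T v) = graph T (br u v).
  exact: semidirect_graph.
have LL u v x : L u (L v x) = L (br u v) x + L v (L u x).
  rewrite -[x](graph_proj_inl T) -!projL -graphS -graph_projD.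
  by rewrite S_leibniz.
have LR u x v : L u (R x v) = R (L u x) v + R x (br u v).
  rewrite -[x](graph_proj_inl T) -!(projL, projR) -graphS -graph_projD.
  by rewrite S_leibniz.
have RR x u v : R x (br u v) = R (R x u) v + L u (R x v).
  rewrite -[x](graph_proj_inl T) -!(projL, projR) -graphS -graph_projD.
  by rewrite S_leibniz.
split; [exact: (actL_bilinear hrep) | exact: (actR_bilinear hrep) | exact: LL
       | exact: LR | exact: RR].
Qed.
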